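(* $\mathsf{Ga}$ is a pretabular logic extending $\mathsf{S4BP}^{2,\omega}_{2,2}$, i.e. $\mathsf{Ga}\in\mathsf{PTAB}(\mathsf{S4BP}^{2,\omega}_{2,2})$.
   Context: Tense formulas use $\Box$ and a past possibility operator written here $\mathsf{P}$; $\mathsf{S4}_t=\mathsf{K}_t\oplus\{\Box p\to p,\Box p\to\Box\Box p\}$. $\mathsf{S4BP}^{2,\omega}_{2,2}$ is $\mathsf{S4}_t$ extended by axioms bounding depth, forth-width and back-width by 2 ($\mathbf{bd}_2=\Diamond(\Box p_1\wedge\neg(\Diamond\Box p_0\to p_0))\to p_1$, $\mathbf{bw}^+_2=\bigwedge_{i\leq2}\Diamond p_i\to\bigvee_{i\neq j\leq2}\Diamond(p_i\wedge(p_j\vee\Diamond p_j))$, $\mathbf{bw}^-_2$ the same with $\mathsf{P}$ for $\Diamond$). Let $\mathfrak{G}_\mathbb{Z}=(\mathbb{Z},R_z)$ with $R_z=\{(i,i):i\in\mathbb{Z}\}\cup\{(2i+1,2i):i\in\mathbb{Z}\}\cup\{(2i+1,2i+2):i\in\mathbb{Z}\}$ and $\mathsf{Ga}=\mathsf{Log}(\mathfrak{G}_\mathbb{Z})$. A logic is pretabular if it is not the logic of a finite frame but all its consistent proper extensions are; $\mathsf{PTAB}(L)$ is the set of pretabular extensions of $L$. *)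

(* Defs.v *)
From mathcomp Require Import all_boot all_order all_algebra.
From mathcomp Require Import boolp classical_sets cardinality.

Set Implicit Arguments.
Unset Strict Implicit.
Unset Printing Implicit Defensive.

Import GRing.Theory.
Local Open Scope classical_set_scope.

Inductive tform : Type :=
| Var of nat
| Bot
| Imp of tform & tform
| Box of tform
| Past of tform.

Definition Neg a := Imp a Bot.
Definition Top := Neg Bot.
Definition Or a b := Imp (Neg a) b.
Definition And a b := Neg (Imp a (Neg b)).
Definition Dia a := Neg (Box (Neg a)).

Fixpoint subst (s : nat -> tform) (a : tform) : tform :=
  match a with
  | Var n => s n
  | Bot => Bot
  | Imp b c => Imp (subst s b) (subst s c)
  | Box b => Box (subst s b)
  | Past b => Past (subst s b)
  end.

(* Boolean evaluation in which variables and formulas headed by a modality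
   are treated as propositional atoms, valued by [v]. *)
Fixpoint beval (v : tform -> bool) (a : tform) : bool :=
  match a with
  | Bot => false
  | Imp b c => beval v b ==> beval v c
  | _ => v a
  end.

(* Substitution instances of classical propositional tautologies. *)
Definition tautology (a : tform) : Prop := forall v : tform -> bool, beval v a.

(* The residuation clause says that [Past] is left adjoint to [Box]; together
   with the other clauses it yields normality of both modalities (axiom K and
   necessitation for [Box], additivity of [Past]). *)
Record tense_logic (L : set tform) : Prop := TenseLogic {
  tl_taut : forall a, tautology a -> L a;
  tl_mp : forall a b, L a -> L (Imp a b) -> L b;
  tl_subst : forall s a, L a -> L (subst s a);
  tl_resid : forall a b, L (Imp (Past a) b) <-> L (Imp a (Box b))
}.

(* Least tense logic containing [L] and [S]. *)
Definition oplus (L S : set tform) : set tform :=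
  \bigcap_(M in [set M | tense_logic M /\ L `|` S `<=` M]) M.

Definition Kt : set tform := \bigcap_(M in tense_logic) M.

Record frame : Type := Frame {
  world :> Type;
  acc : world -> world -> Prop;
  world_inh : inhabited world
}.

Fixpoint sat (F : frame) (V : nat -> set F) (w : F) (a : tform) : Prop :=
  match a with
  | Var n => V n w
  | Bot => False
  | Imp b c => sat V w b -> sat V w c
  | Box b => forall u : F, acc w u -> sat V u b
  | Past b => exists2 u : F, acc u w & sat V u b
  end.

Definition Log (F : frame) : set tform :=
  [set a | forall (V : nat -> set F) (w : F), sat V w a].

Definition consistent (L : set tform) : Prop := ~ L Bot.

Definition tabular (L : set tform) : Prop :=
  exists F : frame, finite_set [set: F] /\ L = Log F.

Definition pretabular (L : set tform) : Prop :=
  [/\ tense_logic L, ~ tabular L &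
      forall M, tense_logic M -> consistent M -> L `<` M -> tabular M].

Definition PTAB (L : set tform) : set (set tform) :=
  [set M | pretabular M /\ L `<=` M].

Definition S4t : set tform :=
  oplus Kt [set Imp (Box (Var 0)) (Var 0);
                Imp (Box (Var 0)) (Box (Box (Var 0)))].

Definition bd1 : tform := Imp (Dia (Box (Var 0))) (Var 0).
Definition bd2 : tform := Imp (Dia (And (Box (Var 1)) (Neg bd1))) (Var 1).

(* Width axiom for a possibility operator [m]: [bw Dia n] bounds forth-width
   and [bw Past n] bounds back-width by [n]; variables are p_0, ..., p_n. *)
Definition bw (m : tform -> tform) (n : nat) : tform :=
  Imp (\big[And/Top]_(i < n.+1) m (Var i))
      (\big[Or/Bot]_(i < n.+1) \big[Or/Bot]_(j < n.+1 | i != j)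
         m (And (Var i) (Or (Var j) (m (Var j))))).

Definition S4BP_2omega_22 : set tform :=
  oplus S4t [set bd2; bw Dia 2; bw Past 2].

Definition Rz (x y : int) : Prop :=
  x = y \/
  exists i : int, x = (2 * i + 1)%R /\ (y = (2 * i)%R \/ y = (2 * i + 2)%R).

Definition GZ : frame := @Frame int Rz (inhabits 0%R).

Definition Ga : set tform := Log GZ.

(* Main.v *)
(** [Ga] is not tabular because a shortest zigzag in a finite frame has bounded
    length, whereas the formulas "[p] holds within [n] zigzag steps" are pairwise
    inequivalent on [GZ].

    Let [M] be a proper consistent extension of [Ga], and let [phi] in [M] fail
    somewhere in [GZ].  Formulas of [Ga] force the canonical frame of [M] to be a
    reflexive graph of height 2 in which every point has at most two neighbours
    besides itself.  A connected component with a long shortest path looks, around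
    the middle of that path, like a piece of [GZ] whose radius exceeds the modal
    depth of [phi].  As finite sets of maximal consistent sets are definable, a
    substitution instance of [phi] would fail there, which is impossible.  Hence
    the components have bounded size.  Being finite they validate [M], and a finite
    disjoint union of copies of them determines [M]. *)

Require Import Defs.
From HB Require Import structures.
From mathcomp Require Import all_boot all_order all_algebra.
From mathcomp Require Import zify.
From mathcomp Require Import boolp classical_sets cardinality.

Set Implicit Arguments.
Unset Strict Implicit.
Unset Printing Implicit Defensive.

Import GRing.Theory.
Local Open Scope classical_set_scope.

(** * Semantics *)

Lemma sat_and (F : frame) (V : nat -> set F) w a b :
  sat V w (And a b) <-> sat V w a /\ sat V w b.
Proof.
split=> /= [H|[Ha Hb]]; last by move=> /(_ Ha).
by apply: contrapT => nab; apply: H => Ha Hb; exact: nab.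
Qed.

Lemma sat_or (F : frame) (V : nat -> set F) w a b :
  sat V w (Or a b) <-> sat V w a \/ sat V w b.
Proof.
split=> /= [H|[Ha|//]]; last by move=> /(_ Ha).
by case: (pselect (sat V w a)) => [|/H]; [left|right].
Qed.

Lemma sat_dia (F : frame) (V : nat -> set F) w a :
  sat V w (Dia a) <-> exists2 u, acc w u & sat V u a.
Proof.
split=> /= [H|[u wu ua]]; last by move=> /(_ u wu).
by apply: contrapT => nu; apply: H => u wu ua; apply: nu; exists u.
Qed.

Lemma sat_subst (F : frame) (V : nat -> set F) s a w :
  sat V w (subst s a) <-> sat (fun n => [set u | sat V u (s n)]) w a.
Proof.
elim: a w => [n||a IHa b IHb|a IHa|a IHa] w //=.
- by rewrite (propext (IHa w)) (propext (IHb w)).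
- by split=> H u /H /IHa.
- by split=> -[u uw /IHa ua]; exists u.
Qed.

Lemma Log_tense_logic (F : frame) : tense_logic (Log F).
Proof.
split=> [a ta V w|a b Ha Hab V w|s a Ha V w|a b].
- have := ta (fun b => `[< sat V w b >]).
  have -> : beval (fun b => `[< sat V w b >]) a = `[< sat V w a >].
    elim: a {ta} => [n||b IHb c IHc|b _|b _] //=; first by rewrite asboolF.
    by rewrite asbool_imply IHb IHc.
  by move/asboolP.
- exact: Hab (Ha V w).
- exact/sat_subst.
- split=> H V w /=.
  + by move=> wa u wu; apply: H; exists w.
  + by case=> u uw ua; apply: (H V u).
Qed.

Fixpoint mdepth (a : tform) : nat :=
  match a with
  | Imp b c => maxn (mdepth b) (mdepth c)
  | Box b | Past b => (mdepth b).+1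
  | _ => 0
  end.

(* With the index of [Z] left unused this is invariance under ordinary
   bisimulations. *)
Lemma sat_bounded_bisim (F G : frame) (V : nat -> set F) (W : nat -> set G)
    (Z : nat -> F -> G -> Prop) :
  (forall k x y n, Z k x y -> V n x <-> W n y) ->
  (forall k x y x', Z k.+1 x y -> acc x x' -> exists2 y', acc y y' & Z k x' y') ->
  (forall k x y y', Z k.+1 x y -> acc y y' -> exists2 x', acc x x' & Z k x' y') ->
  (forall k x y x', Z k.+1 x y -> acc x' x -> exists2 y', acc y' y & Z k x' y') ->
  (forall k x y y', Z k.+1 x y -> acc y' y -> exists2 x', acc x' x & Z k x' y') ->
  forall a k x y, mdepth a <= k -> Z k x y -> sat V x a <-> sat W y a.
Proof.
move=> at_ fo ba pfo pba.
elim=> [n||a IHa b IHb|a IHa|a IHa] k x y //=.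
- by move=> _ /at_.
- rewrite geq_max => /andP[ak bk] Zxy.
  by rewrite (propext (IHa k x y ak Zxy)) (propext (IHb k x y bk Zxy)).
- case: k => // k ak Zxy; split=> H u.
  + by move/(ba _ _ _ _ Zxy) => [x' /H xa] /(IHa _ _ _ ak) /iffLR; apply.
  + by move/(fo _ _ _ _ Zxy) => [x' /H xa] /(IHa _ _ _ ak) /iffRL; apply.
- case: k => // k ak Zxy; split=> -[u].
  + move/(pfo _ _ _ _ Zxy) => [x' ? Zux'] ?; exists x' => //.
    exact/(IHa _ _ _ ak Zux').
  + move/(pba _ _ _ _ Zxy) => [x' ? Zux'] ?; exists x' => //.
    exact/(IHa _ _ _ ak Zux').
Qed.

(** * Canonical models *)

Definition theory (L T : set tform) : Prop :=
  L `<=` T /\ forall a b, T a -> T (Imp a b) -> T b.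

Record mcs (L x : set tform) : Prop := Mcs {
  mcs_theory : theory L x;
  mcs_bot : ~ x Bot;
  mcs_total : forall a, x a \/ x (Neg a)
}.

Ltac taut := let v := fresh "v" in move=> v /=;
  repeat match goal with |- context [beval v ?a] => case: (beval v a)
    | |- context [v ?a] => case: (v a) end.

(** The deduction theorem: this set is the theory generated by [T] together with [a]. *)
Lemma theory_extend L T a : tense_logic L -> theory L T ->
  theory L [set b | T (Imp a b)] /\ T `<=` [set b | T (Imp a b)].
Proof.
move=> tL [LT mpT].
have TT : T `<=` [set b | T (Imp a b)].
  by move=> b Tb; apply: (mpT b) => //; apply/LT/(tl_taut tL); taut.
split=> //; split=> [b Lb|b c /= Tab Tabc]; first exact/TT/LT.
apply: (mpT _ _ Tabc); apply: (mpT _ _ Tab).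
by apply/LT/(tl_taut tL); taut.
Qed.

Lemma lindenbaum L T a : tense_logic L -> theory L T -> ~ T a ->
  exists x, [/\ mcs L x, T `<=` x & ~ x a].
Proof.
move=> tL thT Ta.
have [thT' TT'] := theory_extend (Neg a) tL thT.
set T' := [set b | _] in thT' TT'.
have [_ mpT] := thT; have LT := thT.1.
have T'bot : ~ T' Bot.
  by move=> Tb; apply/Ta/(mpT _ _ Tb)/LT/(tl_taut tL); taut.
(* Zorn's lemma asks that [P] hold of the union of the empty chain as well; joining [T'] reduces
   that case to [T'] being a consistent theory. *)
pose P X := theory L (T' `|` X) /\ ~ (T' `|` X) Bot.
have [F FP totF|X [[thX Xbot] maxX]] := @Zorn_bigcup _ P.
  split; last by move=> [//|[X FX Xb]]; apply: (FP _ FX).2; right.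
  split; first by move=> b /thT'.1; left.
  have key X Y : F X -> F Y -> exists2 Z, F Z & X `|` Y `<=` Z.
    move=> FX FY; have [XY|YX] := totF _ _ FX FY.
    - by exists Y => // b [/XY|].
    - by exists X => // b [|/YX].
  have step X b c : F X -> (T' `|` X) b -> (T' `|` X) (Imp b c) ->
      (T' `|` \bigcup_(Y in F) Y) c.
    move=> FX Xb Xbc; case: ((FP _ FX).1.2 _ _ Xb Xbc); first by left.
    by right; exists X.
  move=> b c [Tb|[X FX Xb]] [Tbc|[Y FY Yc]].
  - by left; apply: thT'.2 Tbc.
  - by apply: (step Y b) => //; [left|right].
  - by apply: (step X b) => //; [right|left].
  - have [Z FZ XYZ] := key _ _ FX FY.
    by apply: (step Z b) => //; right; apply: XYZ; [left|right].
exists (T' `|` X); split.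
- split=> // b.
  have [thXb XXb] := theory_extend b tL thX.
  set Xb := [set c | _] in thXb XXb.
  have bXb : Xb b by apply/thX.1/(tl_taut tL); taut.
  have T'Xb : T' `|` Xb = Xb.
    by apply/seteqP; split=> c; [case=> // ?; apply: XXb; left|right].
  case: (pselect (Xb Bot)) => [|nXb]; first by right.
  left; apply: contrapT => nb; apply: (maxX Xb); last by rewrite /P T'Xb.
  split; first by move=> c Xc; apply: XXb; right.
  by move=> /(_ _ bXb) Xb'; apply: nb; right.
- by move=> b /TT'; left.
- move=> xa; apply: Xbot; apply: (thX.2 _ _ xa); left.
  by apply/LT/(tl_taut tL); taut.
Qed.

Definition canon_world (L : set tform) : Type := {x : set tform | mcs L x}.

HB.instance Definition _ (L : set tform) := gen_eqMixin (canon_world L).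

Definition canon_acc (L : set tform) (x y : canon_world L) : Prop :=
  forall a, sval x (Box a) -> sval y a.

Lemma canon_ext L (x y : canon_world L) : (forall a, sval x a -> sval y a) -> x = y.
Proof.
case: x y => [x hx] [y hy] /= xy; apply: eq_exist.
apply/seteqP; split=> // a ya.
case: (mcs_total hx a) => // /xy yna; case: (mcs_bot hy).
exact: (mcs_theory hy).2 ya yna.
Qed.

Lemma canon_separated L (x y : canon_world L) :
  x <> y -> exists2 a, sval x a & ~ sval y a.
Proof.
move=> xy; apply: contrapT => H; apply/xy/canon_ext => a xa.
by apply: contrapT => ya; apply: H; exists a.
Qed.

Lemma canon_bot L (x : canon_world L) : ~ sval x Bot.
Proof. exact: mcs_bot (svalP x). Qed.

Lemma canon_thm L (x : canon_world L) a : L a -> sval x a.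
Proof. exact: (mcs_theory (svalP x)).1. Qed.

Lemma canon_imp L (x : canon_world L) a b : tense_logic L ->
  sval x (Imp a b) <-> (sval x a -> sval x b).
Proof.
move=> tL; case: x => x [[Lx mpx] xbot xtot] /=.
split=> [xab xa|H]; first exact: mpx xab.
have [/H xb|xna] := xtot a.
- by apply: (mpx _ _ xb); apply/Lx/(tl_taut tL); taut.
- by apply: (mpx _ _ xna); apply/Lx/(tl_taut tL); taut.
Qed.

Lemma canon_neg L (x : canon_world L) a : tense_logic L ->
  sval x (Neg a) <-> ~ sval x a.
Proof.
move=> tL; rewrite /Neg (propext (canon_imp x a Bot tL)).
by split=> // H /H; exact: canon_bot.
Qed.

Lemma canon_complete L a : tense_logic L ->
  L a <-> forall x : canon_world L, sval x a.
Proof.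
move=> tL; split=> [La x|H]; first exact: canon_thm.
apply: contrapT => nLa.
have thL : theory L L by split=> // b c; exact: (tl_mp tL).
have [x [hx _ xa]] := lindenbaum tL thL nLa.
exact: xa (H (exist _ x hx)).
Qed.

(** Residuation is the only modal rule, so necessitation and axiom K for [Box] are first derived
    from it. They make the formulas [b] with [Box b] in [x] a theory, which Lindenbaum's lemma
    extends to a successor omitting [a]. *)
Lemma canon_box L (x : canon_world L) a : tense_logic L ->
  sval x (Box a) <-> forall y, canon_acc x y -> sval y a.
Proof.
move=> tL; split=> [xa y xy|H]; first exact: xy.
apply: contrapT => nxa.
have thx : theory L [set b | sval x (Box b)].
  split=> [b Lb|b c /= xb xbc].
    have /(canon_thm x) : L (Imp Top (Box b)).
      apply/(tl_resid tL); apply: (tl_mp tL Lb); apply: (tl_taut tL).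
      by taut.
    move/(canon_imp _ _ _ tL); apply; apply/canon_thm/(tl_taut tL).
    by move=> v.
  (* [Past d] implies both [b] and [Imp b c], hence [c]; moving back across the adjunction gives
     axiom K. *)
  set d := And (Box b) (Box (Imp b c)).
  have dP (y : canon_world L) : sval y d <-> sval y (Box b) /\ sval y (Box (Imp b c)).
    rewrite /d (propext (canon_neg _ _ tL)) (propext (canon_imp _ _ _ tL)).
    rewrite (propext (canon_neg _ _ tL)).
    split=> [h|[? ?] h]; last exact: h.
    by split; apply: contrapT => h'; apply: h.
  have h e : L (Imp d (Box e)) -> L (Imp (Past d) e) by move/(tl_resid tL).
  have h1 : L (Imp (Past d) b).
    by apply/h/(canon_complete _ tL) => y; apply/(canon_imp _ _ _ tL) => /dP[].
  have h2 : L (Imp (Past d) (Imp b c)).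
    by apply/h/(canon_complete _ tL) => y; apply/(canon_imp _ _ _ tL) => /dP[].
  have /(canon_thm x) : L (Imp d (Box c)).
    apply/(tl_resid tL); apply: (tl_mp tL h2); apply: (tl_mp tL h1).
    by apply: (tl_taut tL); taut.
  by move/(canon_imp _ _ _ tL); apply; apply/dP.
have [y [hy xy ya]] := lindenbaum tL thx nxa.
by apply: ya; apply: (H (exist _ y hy)) => b /xy.
Qed.

(** The unit [a -> Box (Past a)] and the counit [Past (Box a) -> a] of the adjunction make one
    relation serve both modalities. *)
Lemma canon_accP L (x y : canon_world L) : tense_logic L ->
  canon_acc x y <-> forall a, sval x a -> sval y (Past a).
Proof.
move=> tL; split=> [xy a xa|H a xa].
- apply: xy; have /(canon_thm x) : L (Imp a (Box (Past a))).
    by apply/(tl_resid tL)/(tl_taut tL); taut.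
  by move/(canon_imp _ _ _ tL); apply.
- have /(canon_thm y) : L (Imp (Past (Box a)) a).
    by apply/(tl_resid tL)/(tl_taut tL); taut.
  by move/(canon_imp _ _ _ tL); apply; apply: H.
Qed.

(** Dual to [canon_box]: monotonicity and additivity of [Past] make the formulas [b] with
    [Past (Neg b)] outside [y] a theory, and a suitable maximal consistent extension of it is the
    predecessor sought. *)
Lemma canon_past L (y : canon_world L) a : tense_logic L ->
  sval y (Past a) <-> exists2 x, canon_acc x y & sval x a.
Proof.
move=> tL; split=> [ya|[x /(canon_accP _ _ tL)]]; last by move=> xy /xy.
have monP b c : L (Imp b c) -> L (Imp (Past b) (Past c)).
  move=> bc; apply/(tl_resid tL)/(canon_complete _ tL) => x.
  apply/(canon_imp _ _ _ tL) => xb; apply/(canon_box _ _ tL) => z.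
  move/(canon_accP _ _ tL); apply; apply: (iffLR (canon_imp _ _ _ tL) _ xb).
  exact: canon_thm.
have thy : theory L [set b | ~ sval y (Past (Neg b))].
  split=> [b Lb /=|b c /= yb ybc yc].
    have /(canon_thm y) : L (Imp (Past (Neg b)) Bot).
      apply/(tl_resid tL)/(canon_complete _ tL) => x.
      apply/(canon_imp _ _ _ tL) => /(canon_neg _ _ tL) [].
      exact: canon_thm.
    by move/(canon_imp _ _ _ tL) => H /H; exact: canon_bot.
  set d := Or (Past (Neg b)) (Past (Neg (Imp b c))).
  (* Additivity of [Past]: a point omitting [c] omits [b] or [Imp b c], and passes this on through
     [Past] to each successor [z]. *)
  have /(canon_thm y) : L (Imp (Past (Neg c)) d).
    apply/(tl_resid tL)/(canon_complete _ tL) => x.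
    apply/(canon_imp _ _ _ tL) => /(canon_neg _ _ tL) xc.
    apply/(canon_box _ _ tL) => z /(canon_accP _ _ tL) xz.
    apply/(canon_imp _ _ _ tL) => /(canon_neg _ _ tL) zb.
    apply: (xz); apply/(canon_neg _ _ tL) => /(canon_imp _ _ _ tL) xbc.
    apply: xc; apply: xbc; apply: contrapT => xb; apply/zb/xz.
    exact/(canon_neg _ _ tL).
  move/(canon_imp _ _ _ tL)/(_ yc)/(canon_imp _ _ _ tL) => H.
  by apply/ybc/H/(canon_neg _ _ tL).
have [|x [hx yx xa]] := lindenbaum (a := Neg a) tL thy.
  apply; apply: (iffLR (canon_imp _ _ _ tL) _ ya).
  by apply/canon_thm/monP/(tl_taut tL); taut.
exists (exist _ x hx).
  apply/(canon_accP _ _ tL) => b xb; apply: contrapT => nyb.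
  have /yx : ~ sval y (Past (Neg (Neg b))).
    move=> h; apply: nyb; apply: (iffLR (canon_imp _ _ _ tL) _ h).
    by apply/canon_thm/monP/(tl_taut tL); taut.
  by apply/(canon_neg (exist _ x hx) _ tL).
apply: contrapT => nxa; apply: xa.
exact/(canon_neg (exist _ x hx) _ tL).
Qed.

Definition canon_frame (L : set tform) (i : inhabited (canon_world L)) : frame :=
  Frame (@canon_acc L) i.

(** Variables denote arbitrary formulas [s n], so closure of [L] under substitution makes its
    theorems true under every definable valuation, not only the standard one. *)
Lemma canon_truth L (i : inhabited (canon_world L)) s a (x : canon_frame i) :
  tense_logic L ->
  sat (fun n => [set y : canon_frame i | sval y (s n)]) x a <->
  sval x (subst s a).
Proof.
move=> tL; elim: a x => [n||a IHa b IHb|a IHa|a IHa] x //=.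
- by split=> // /canon_bot.
- by rewrite (propext (IHa x)) (propext (IHb x)) (propext (canon_imp _ _ _ tL)).
- rewrite (propext (canon_box _ _ tL)).
  by split=> H y /H /IHa.
- rewrite (propext (canon_past _ _ tL)).
  by split=> -[y yx /IHa ya]; exists y.
Qed.

Lemma canon_sound L (i : inhabited (canon_world L)) s a (x : canon_frame i) :
  tense_logic L -> L a ->
  sat (fun n => [set y : canon_frame i | sval y (s n)]) x a.
Proof.
by move=> tL La; apply/(canon_truth _ _ _ tL)/canon_thm/(tl_subst tL).
Qed.

(* Distinct maximal consistent sets are separated by a formula, so every
   valuation restricted to finitely many points is given by formulas. *)
Lemma canon_definable L (s : seq (canon_world L)) (Q : canon_world L -> Prop) :
  tense_logic L ->
  exists a, forall x, x \in s -> sval x a <-> Q x.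
Proof.
move=> tL.
have conj (x : canon_world L) a b : sval x (And a b) <-> sval x a /\ sval x b.
  rewrite (propext (canon_neg _ _ tL)) (propext (canon_imp _ _ _ tL)).
  rewrite (propext (canon_neg _ _ tL)).
  split=> [h|[? ?] h]; last exact: h.
  by split; apply: contrapT => h'; apply: h.
have sep (t : seq (canon_world L)) x : x \notin t ->
    exists2 d, sval x d & forall y, y \in t -> ~ sval y d.
  elim: t => [|y t IH].
    by exists Top => //; apply/canon_thm/(tl_taut tL).
  rewrite inE negb_or => /andP[xy /IH[d xd td]].
  have [b xb yb] := canon_separated (elimN eqP xy).
  exists (And b d); first exact/conj.
  by move=> z; rewrite inE => /orP[/eqP->|/td zd] /conj[].
elim: s => [|x s [a IH]]; first by exists Bot.
have [xs|/sep[d xd sd]] := boolP (x \in s).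
  by exists a => y; rewrite inE => /orP[/eqP->|]; exact: IH.
have [Qx|nQx] := pselect (Q x).
  exists (Imp (Neg a) d) => y.
  rewrite (propext (canon_imp _ _ _ tL)) (propext (canon_neg _ _ tL)).
  rewrite inE => /orP[/eqP->|ys]; first by split.
  rewrite -(propext (IH _ ys)); have := sd _ ys.
  by split=> // h; apply: contrapT => /h.
exists (And a (Neg d)) => y.
rewrite (propext (conj _ _ _)) (propext (canon_neg _ _ tL)).
rewrite inE => /orP[/eqP->|ys]; first by split=> // -[].
by rewrite -(propext (IH _ ys)); have := sd _ ys; split=> // -[].
Qed.

Lemma sat_imp (F : frame) (V : nat -> set F) w a b :
  sat V w (Imp a b) = (sat V w a -> sat V w b).
Proof. by []. Qed.

(** * Balls and shortest paths *)

(** For reflexive [E] these are the points at distance at most [n] from [x]. *)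
Fixpoint ball (T : Type) (E : T -> T -> Prop) (x : T) (n : nat) (y : T) : Prop :=
  if n is n'.+1 then exists2 z, ball E x n' z & E z y else y = x.

Lemma ball_leq (T : Type) (E : T -> T -> Prop) x m n y :
  (forall z, E z z) -> m <= n -> ball E x m y -> ball E x n y.
Proof.
move=> rE /subnK <-; elim: (n - m) => // k IH /IH; rewrite addSn.
by exists y.
Qed.

Lemma ball_shortest_path (T : Type) (E : T -> T -> Prop) x n y :
  (forall z, E z z) -> ball E x n.+1 y -> ~ ball E x n y ->
  exists p : nat -> T,
    (forall i, i <= n -> E (p i) (p i.+1)) /\
    (forall i j, i <= n.+1 -> j <= n.+1 -> p i = p j -> i = j).
Proof.
move=> rE Hy nHy.
(* Asking that [p i] lie at distance exactly [i] from [x] forces injectivity and lets the induction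
   go through. *)
suff [p [pE pB]] : exists p : nat -> T,
    (forall i, i < n.+1 -> E (p i) (p i.+1)) /\
    (forall i, i <= n.+1 ->
      ball E x i (p i) /\ (forall j, j < i -> ~ ball E x j (p i))).
  exists p; split=> //.
  have lt i j : i < j -> j <= n.+1 -> p i <> p j.
    move=> ij jn pij; case: (pB j jn) => _ /(_ _ ij); apply.
    by rewrite -pij; case: (pB i) => //; exact: leq_trans (ltnW ij) jn.
  move=> i j ni nj pij; case: (ltngtP i j) => // ij.
  - by case: (lt _ _ ij nj).
  - by case: (lt _ _ ij ni).
have : forall j, j < n.+1 -> ~ ball E x j y.
  by move=> j jn /(ball_leq rE (jn : j <= n)).
suff: forall m z, ball E x m z -> (forall j, j < m -> ~ ball E x j z) ->
    exists p : nat -> T, [/\ p m = z, forall i, i < m -> E (p i) (p i.+1) &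
      forall i, i <= m ->
        ball E x i (p i) /\ (forall j, j < i -> ~ ball E x j (p i))].
  by move=> H /(H _ _ Hy)[p [_ ? ?]]; exists p.
elim=> [|m IH] z.
  by move=> zx _; exists (fun=> z); split=> // i; rewrite leqn0 => /eqP->.
move=> mz nz; have [u mu uz] := mz.
have [j jm|p [pm pE pB]] := IH u mu.
  by move=> ju; apply: (nz j.+1) => //; exists u.
exists (fun i => if i <= m then p i else z); split; first by rewrite ltnn.
- move=> i; rewrite ltnS => im; rewrite im; case: ltnP => [/pE//|mi].
  by have -> : i = m; [apply/eqP; rewrite eqn_leq im|rewrite pm].
- move=> i im; case: leqP => [/pB//|mi].
  by have -> : i = m.+1; [apply/eqP; rewrite eqn_leq im|].
Qed.

(** Turns a negative degree bound, the form in which the [alt3] formulas give it, into an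
    enumeration, by removing one element of [P] at a time. *)
Lemma bounded_enum (T : eqType) (n : nat) (P : T -> Prop) :
  (forall s : seq T, uniq s -> size s = n.+1 -> ~ (forall y, y \in s -> P y)) ->
  exists s : seq T, size s <= n /\ (forall y, P y -> y \in s).
Proof.
elim: n P => [|n IH] P HP.
  exists [::]; split=> // y Py; exfalso; apply: (HP [:: y]) => // z.
  by rewrite inE => /eqP->.
have [[y Py]|nP] := pselect (exists y, P y); last first.
  by exists [::]; split=> // y Py; exfalso; apply: nP; exists y.
have [s us ss sP|s [ss sP]] := IH (fun z => P z /\ z != y).
  apply: (HP (y :: s)); rewrite /= ?ss ?us ?andbT //.
    by apply/negP => /sP[_]; rewrite eqxx.
  by move=> z; rewrite inE => /orP[/eqP->|/sP[]].
exists (y :: s); split=> // z Pz; rewrite inE.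
by have [//|zy] := eqVneq z y; apply: sP.
Qed.

Lemma ball_enum (T : eqType) (E : T -> T -> Prop) x d n :
  (forall z, exists s : seq T, size s <= d /\ (forall y, E z y -> y \in s)) ->
  exists s : seq T, size s <= d ^ n /\ (forall y, ball E x n y -> y \in s).
Proof.
move=> /choice[nb Hnb].
elim: n => [|n [s [ss Hs]]].
  by exists [:: x]; split=> // y /= ->; rewrite inE.
(* The default [z] pads every neighbour list to length [d], so the size is exactly [size s * d]. *)
exists [seq nth z (nb z) i | z <- s, i <- iota 0 d]; split.
  by rewrite size_allpairs size_iota expnSr leq_mul2r ss orbT.
move=> y [z /Hs zs zy]; have [sz /(_ _ zy) ynb] := Hnb z.
apply/allpairsP; exists (z, index y (nb z)); split=> //=; last by rewrite nth_index.
by rewrite mem_iota (leq_trans _ sz) // index_mem.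
Qed.

(** Either some point lies at distance exactly [n.+1], and a shortest path to it is long, or the
    ball of radius [n] is already closed under [E]. *)
Lemma long_path_or_small_component (T : eqType) (E : T -> T -> Prop) x d n :
  (forall z, E z z) ->
  (forall z, exists s : seq T, size s <= d /\ (forall y, E z y -> y \in s)) ->
  (exists p : nat -> T,
    (forall i, i <= n -> E (p i) (p i.+1)) /\
    (forall i j, i <= n.+1 -> j <= n.+1 -> p i = p j -> i = j)) \/
  (exists s : seq T, [/\ uniq s, size s <= d ^ n, x \in s &
    forall z y, z \in s -> E z y -> y \in s]).
Proof.
move=> rE dE.
have [[y Hy nHy]|H] := pselect (exists2 y, ball E x n.+1 y & ~ ball E x n y).
  by left; exact: ball_shortest_path Hy nHy.
right; have [s [ss sP]] := ball_enum x n dE.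
(* The enumeration [s] may list points outside the ball, while closure under [E] holds for the ball
   itself. *)
exists (undup [seq y <- s | `[< ball E x n y >]]); split.
- exact: undup_uniq.
- by rewrite (leq_trans (size_undup _)) // size_filter (leq_trans (count_size _ _)).
- have xB : ball E x n x by exact: (ball_leq (m := 0)).
  by rewrite mem_undup mem_filter sP // andbT; apply/asboolP.
- move=> z y; rewrite !mem_undup !mem_filter => /andP[/asboolP zB _] zy.
  have yB : ball E x n y.
    by apply: contrapT => ny; apply: H; exists y => //; exists z.
  by rewrite sP // andbT; apply/asboolP.
Qed.

(** * The fence on the integers *)

Lemma Rz_refl x : Rz x x.
Proof. by left. Qed.

Lemma Rz_depth x y z : Rz x y -> Rz y z -> x = y \/ y = z.
Proof. by rewrite /Rz => -[->|[i [-> [->|->]]]] [->|[j [? [?|?]]]]; lia. Qed.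

Lemma Rz_near x y : Rz x y -> y = x \/ y = (x - 1)%R \/ y = (x + 1)%R.
Proof. by rewrite /Rz => -[->|[i [-> [->|->]]]]; lia. Qed.

Lemma uniq4P (T : eqType) (y0 y1 y2 y3 : T) : uniq [:: y0; y1; y2; y3] <->
  [/\ y0 <> y1, y0 <> y2 & y0 <> y3] /\ [/\ y1 <> y2, y1 <> y3 & y2 <> y3].
Proof.
rewrite /= !inE !negb_or !andbT.
split=> [/and3P[/and3P[/eqP ? /eqP ? /eqP ?] /andP[/eqP ? /eqP ?] /eqP ?]//|].
by move=> [[/eqP-> /eqP-> /eqP->] [/eqP-> /eqP-> /eqP->]].
Qed.

Lemma four_near (x y0 y1 y2 y3 : int) :
  (forall y, y \in [:: y0; y1; y2; y3] -> y = x \/ y = (x - 1)%R \/ y = (x + 1)%R) ->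
  ~~ uniq [:: y0; y1; y2; y3].
Proof.
move=> H; have [] : [/\ y0 \in [:: y0; y1; y2; y3], y1 \in [:: y0; y1; y2; y3],
  y2 \in [:: y0; y1; y2; y3] & y3 \in [:: y0; y1; y2; y3]].
  by rewrite !inE !eqxx !orbT.
move=> /H h0 /H h1 /H h2 /H h3.
apply/negP => /uniq4P[[n01 n02 n03] [n12 n13 n23]].
by case: h0 h1 h2 h3 n01 n02 n03 n12 n13 n23 => [->|[]->] [->|[]->] [->|[]->] [->|[]->].
Qed.

(** * Formulas valid on the fence *)

Definition HBox (a : tform) : tform := Neg (Past (Neg a)).

Lemma sat_HBox (F : frame) (V : nat -> set F) w a :
  sat V w (HBox a) <-> forall u, acc u w -> sat V u a.
Proof.
split=> /= [H u uw|H [u uw]]; last by apply; exact: H.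
by apply: contrapT => nu; apply: H; exists u.
Qed.

Definition refl_form := Imp (Box (Var 0)) (Var 0).

(** On a frame this says that of two consecutive steps one is a loop, which excludes both chains of
    three points and two-point clusters. *)
Definition depth_form :=
  Imp (Var 0) (Box (Imp (Neg (Var 0)) (Imp (Var 1) (Box (Var 1))))).

(* The standard axiom [alt_3] for the box operator [m]: at most three points
   are accessible. *)
Definition alt3 (m : tform -> tform) : tform :=
  Imp (Neg (m (Var 0)))
 (Imp (Neg (m (Imp (Var 0) (Var 1))))
 (Imp (Neg (m (Imp (Var 0) (Imp (Var 1) (Var 2)))))
      (m (Imp (Var 0) (Imp (Var 1) (Imp (Var 2) (Var 3))))))).

(** Treats [Box] and its past dual [HBox] uniformly; for the latter [R] is the converse of
    accessibility. *)
Definition box_for (F : frame) (m : tform -> tform) (R : F -> F -> Prop) : Prop :=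
  forall V w a, sat (F := F) V w (m a) <-> forall u, R w u -> sat V u a.

Lemma box_for_Box (F : frame) : box_for Box (@acc F).
Proof. by []. Qed.

Lemma box_for_HBox (F : frame) : box_for HBox (fun x y => @acc F y x).
Proof. by move=> V w a; exact: sat_HBox. Qed.

(** Each witness of failure satisfies the variables refuted by the earlier ones, so the four are
    distinct; but only [w] and its two neighbouring integers are available. *)
Lemma Ga_alt3 m R : box_for (F := GZ) m R ->
  (forall x y, R x y -> y = x \/ y = (x - 1)%R \/ y = (x + 1)%R) -> Ga (alt3 m).
Proof.
move=> mR near V w /=.
have nm a : ~ sat V w (m a) -> exists2 u, R w u & ~ sat V u a.
  rewrite (propext (mR _ _ _)) => H; apply: contrapT => nu; apply: H => u wu.
  by apply: contrapT => nua; apply: nu; exists u.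
move=> /nm[y0 wy0 /= n0] /nm[y1 wy1 /= n1] /nm[y2 wy2 /= n2].
apply/(iffRL (mR _ _ _)) => y3 wy3 /= p0 p1 p2; apply: contrapT => n3.
have /negP[] : ~~ uniq [:: y0; y1; y2; y3].
  apply: (@four_near w) => y; rewrite !inE => /or4P[] /eqP->; exact: near.
rewrite /= !inE !negb_or !andbT.
have q0 y : V 0 y -> y0 != y by move=> yV; apply/eqP => E; apply: n0; rewrite E.
have q1 y : V 1 y -> y1 != y.
  by move=> yV; apply/eqP => E; apply: n1; rewrite E.
have q2 y : V 2 y -> y2 != y.
  by move=> yV; apply/eqP => E; apply: n2; rewrite E.
have v01 : V 0 y1 by apply: contrapT => h; apply: n1 => /h.
have v02 : V 0 y2 by apply: contrapT => h; apply: n2 => /h.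
have v12 : V 1 y2 by apply: contrapT => h; apply: n2 => _ /h.
by rewrite !q0 // !q1 // q2.
Qed.

Lemma Ga_refl : Ga refl_form.
Proof. by move=> V w /= H; apply: H; exact: Rz_refl. Qed.

Lemma Ga_depth : Ga depth_form.
Proof.
move=> V w /= V0 u wu nV0 V1 v uv.
by case: (Rz_depth wu uv) => E; [case: nV0; rewrite -E|rewrite -E].
Qed.

Lemma Ga_bd2 : Ga bd2.
Proof.
move=> V w; rewrite /bd2 sat_imp =>  /sat_dia[u wu /sat_and[u1 nbd]].
have [<-|uN] := pselect (u = w); first by apply: u1; exact: Rz_refl.
exfalso; apply: (nbd : ~ sat V u bd1); rewrite /bd1 sat_imp => /sat_dia[v uv v0]; apply: v0.
have [E|<-] := Rz_depth wu uv; first by case: uN.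
exact: Rz_refl.
Qed.

Lemma sat_big_or (F : frame) (V : nat -> set F) w (I : finType) (P : pred I) f :
  sat V w (\big[Or/Bot]_(i | P i) f i) <-> exists2 i, P i & sat V w (f i).
Proof.
rewrite -big_filter; set r := [seq _ <- _ | _].
have -> : (exists2 i, P i & sat V w (f i)) <->
    (exists2 i, i \in r & sat V w (f i)).
  by split=> -[i Pi fi]; exists i => //; move: Pi; rewrite mem_filter mem_index_enum andbT.
elim: r => [|j r IH]; first by rewrite big_nil; split=> [[]|[i]]; rewrite ?in_nil.
rewrite big_cons (propext (sat_or _ _ _ _)) (propext IH).
split=> [[h|[i ir h]]|[i]]; first by exists j => //; rewrite mem_head.
  by exists i => //; rewrite inE ir orbT.
by rewrite inE => /orP[/eqP->|ir] h; [left|right; exists i].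
Qed.

Lemma sat_big_and (F : frame) (V : nat -> set F) w (I : finType) f :
  sat V w (\big[And/Top]_(i : I) f i) <-> forall i, sat V w (f i).
Proof.
have -> : (forall i, sat V w (f i)) <->
    (forall i, i \in index_enum I -> sat V w (f i)).
  by split=> H i => [_|]; [exact: H|apply: H; rewrite mem_index_enum].
elim: (index_enum I) => [|j r IH]; first by rewrite big_nil; split=> [_ i|_ []]; rewrite ?in_nil.
rewrite big_cons (propext (sat_and _ _ _ _)) (propext IH).
split=> [[h H] i|H]; first by rewrite inE => /orP[/eqP->//|/H].
by split=> [|i ir]; apply: H; rewrite inE ?eqxx ?ir ?orbT.
Qed.

(** Of three witnesses among [w - 1], [w], [w + 1], either one is [w], which sees the others, or two
    coincide, and then reflexivity applies. *)
Lemma Ga_bw m R :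
  (forall V w a, sat (F := GZ) V w (m a) <-> exists2 u, R w u & sat V u a) ->
  (forall x, R x x) ->
  (forall x y, R x y -> y = x \/ y = (x - 1)%R \/ y = (x + 1)%R) ->
  Ga (bw m 2).
Proof.
move=> mR rR near V w; rewrite /bw sat_imp => /sat_big_and H; apply/sat_big_or.
have {}H (i : 'I_3) : exists2 u, R w u & V (nat_of_ord i) u by move: (H i) => /mR.
have /choice[u Hu] : forall i : 'I_3, exists v, R w v /\ V i v.
  by move=> i; have [v ? ?] := H i; exists v.
have fin i j : i != j -> R (u i) (u j) ->
    sat (F := GZ) V w (m (And (Var i) (Or (Var j) (m (Var j))))).
  move=> ij Rij; apply/mR; exists (u i); first exact: (Hu i).1.
  apply/sat_and; split; first exact: (Hu i).2.
  by apply/sat_or; right; apply/mR; exists (u j) => //; exact: (Hu j).2.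
suff [i [j [ij Rij]]] : exists i j : 'I_3, i != j /\ R (u i) (u j).
  by exists i => //; apply/sat_big_or; exists j => //; exact: fin.
have [[k Ek]|nk] := pselect (exists k, u k = w).
  have [E|E] := eqVneq k ord0.
    by exists k, ord_max; split; [rewrite E|rewrite Ek; exact: (Hu _).1].
  by exists k, ord0; split=> //; rewrite Ek; exact: (Hu _).1.
have nr k : u k = (w - 1)%R \/ u k = (w + 1)%R.
  by case: (near _ _ (Hu k).1) => // E; case: nk; exists k.
have [n0 [n1 n2]] := (nr ord0, (nr (inord 1), nr ord_max)).
have pair i j : i != j -> u i = u j -> exists i j : 'I_3, i != j /\ R (u i) (u j).
  by move=> ij E; exists i, j; split=> //; rewrite E; exact: rR.
have d01 : ord0 != inord 1 :> 'I_3 by rewrite -val_eqE /= inordK.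
have d12 : inord 1 != ord_max :> 'I_3 by rewrite -val_eqE /= inordK.
have d02 : ord0 != ord_max :> 'I_3 by [].
have := (pair _ _ d01, (pair _ _ d12, pair _ _ d02)).
move=> [h01 [h12 h02]].
have [E|N01] := pselect (u ord0 = u (inord 1)); first exact: h01.
have [E|N12] := pselect (u (inord 1) = u ord_max); first exact: h12.
by apply: h02; move: n0 n1 n2 N01 N12 => [->|->] [->|->] [->|->].
Qed.

Lemma S4BP_sub_Ga : S4BP_2omega_22 `<=` Ga.
Proof.
have tG : tense_logic Ga by exact: Log_tense_logic.
have KG : Kt `<=` Ga by move=> a; apply.
have SG : S4t `<=` Ga.
  move=> a; apply; split=> // b [/KG//|[]->]; first exact: Ga_refl.
  move=> V w /= H u wu v uv; apply: H.
  by case: (Rz_depth wu uv) => [->|<-].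
have near x y : Rz y x -> y = x \/ y = (x - 1)%R \/ y = (x + 1)%R.
  by move/Rz_near; lia.
move=> a; apply; split=> // b [/SG//|[[]|]->]; first exact: Ga_bd2.
- apply: (@Ga_bw _ Rz); [exact: sat_dia|exact: Rz_refl|exact: Rz_near].
- by apply: (@Ga_bw _ (fun x y => Rz y x)); [|exact: Rz_refl|exact: near].
Qed.

(** * [Ga] is not tabular *)

Definition Step (a : tform) : tform := Or (Dia a) (Past a).

Definition adj (F : frame) (x y : F) : Prop := acc x y \/ acc y x.

Lemma sat_Step (F : frame) (V : nat -> set F) n w :
  sat V w (iter n Step (Var 0)) <-> exists2 u, ball (@adj F) u n w & V 0 u.
Proof.
elim: n w => [|n IH] w.
  by split=> [h|[u ->]//]; exists w.
rewrite iterS (propext (sat_or _ _ _ _)) (propext (sat_dia _ _ _)).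
split=> [[]|[u [z uz [zw|wz]] Vu]].
- by move=> [z wz] /IH[u uz Vu]; exists u => //; exists z => //; right.
- by move=> [z zw] /IH[u uz Vu]; exists u => //; exists z => //; left.
- by right; exists z => //; apply/IH; exists u.
- by left; exists z => //; apply/IH; exists u.
Qed.

Lemma GZ_adj_dist (x y : int) : @adj GZ x y -> (`|x| <= `|y| + 1)%N.
Proof. by case=> /Rz_near; lia. Qed.

Lemma GZ_adj_succ (n : nat) : @adj GZ (Posz n) (Posz n.+1).
Proof.
rewrite -(odd_double_half n); set q := n./2.
case: (odd n); [left|right]; right; exists (Posz q); split; [|right| |left]; lia.
Qed.

Lemma Ga_not_tabular : ~ tabular Ga.
Proof.
case=> F [/(@finite_seqP {classic F})[s Fs] GaF].
(* Validity of the T axiom makes [F] reflexive: let the variable hold at the successors of [x]. *)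
have rF (x : F) : adj x x.
  left; have : Log F refl_form by rewrite -GaF; exact: Ga_refl.
  by move=> /(_ (fun=> [set u | acc x u]) x) /=; apply.
set n := size s.
(* Valid in [F], since a shortest path with [n.+1] edges visits [n.+2] distinct points, more than
   [F] has. *)
pose phi := Imp (iter n.+1 Step (Var 0)) (iter n Step (Var 0)).
have : Ga phi.
  rewrite GaF => V w; rewrite /phi sat_imp => /sat_Step[u wu Vu].
  apply: contrapT => nw.
  have nwu : ~ ball (@adj F) u n w by move=> h; apply: nw; apply/sat_Step; exists u.
  have [p [_ pinj]] := ball_shortest_path rF wu nwu.
  pose ps : seq {classic F} := [seq (p i : {classic F}) | i <- iota 0 n.+2].
  have ups : uniq ps.
    rewrite map_inj_in_uniq ?iota_uniq // => i j.
    by rewrite !mem_iota !add0n /= => ni nj; exact: pinj.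
  have : size ps <= size s.
    apply: uniq_leq_size => // x _.
    by have : [set: {classic F}] x by []; rewrite Fs.
  by rewrite size_map size_iota -/n; lia.
(* On [GZ] the formula fails at [n.+1] when the variable holds only at [0], since a step raises the
   absolute value by at most one. *)
move=> /(_ (fun=> [set 0%R : int]) (Posz n.+1)).
rewrite /phi sat_imp => H.
have /H/sat_Step[u] : sat (F := GZ) (fun=> [set 0%R : int]) (Posz n.+1)
    (iter n.+1 Step (Var 0)).
  apply/sat_Step; exists (Posz 0) => //.
  elim: (n.+1) => [//|k IH]; exists (Posz k) => //; exact: GZ_adj_succ.
move=> + u0; rewrite {}u0.
have far k x : ball (@adj GZ) 0%R k x -> (`|x| <= k)%N.
  elim: k x => [x /= ->//|k IH x /= [z /IH zk]] zx.
  by have := @GZ_adj_dist x z (iffLR (or_comm _ _) zx); lia.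
by move=> /far; lia.
Qed.

(** * Canonical frames of extensions of [Ga] *)

Lemma canon_refl L (i : inhabited (canon_world L)) (x : canon_frame i) :
  tense_logic L -> Ga `<=` L -> acc x x.
Proof.
move=> tL GL a xa.
have La : L (Imp (Box a) a) := tl_subst tL (fun=> a) (GL _ Ga_refl).
exact: (iffLR (canon_imp _ _ _ tL) (canon_thm _ La)).
Qed.

(** Theorems are known to hold only under definable valuations, so the variables are replaced by
    formulas separating [x] from [y] and [y] from [z]. *)
Lemma canon_depth L (i : inhabited (canon_world L)) (x y z : canon_frame i) :
  tense_logic L -> Ga `<=` L -> acc x y -> acc y z -> x = y \/ y = z.
Proof.
move=> tL GL xy yz; apply: contrapT => /not_orP[].
move=> /canon_separated[a xa ya] /canon_separated[b yb zb].
have := canon_sound (fun n => if n == 0 then a else b) x tL (GL _ Ga_depth).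
by move=> /(_ xa _ xy ya yb _ yz).
Qed.

(** Variable [k] is replaced by a formula true at all four points but the [k]-th; if all four were
    accessible, the premises of [alt3] would hold at [x] and its conclusion fail. *)
Lemma canon_alt3 L (i : inhabited (canon_world L)) m R (x : canon_frame i)
    (s : seq (canon_world L)) :
  tense_logic L -> Ga `<=` L -> Ga (alt3 m) -> box_for m R ->
  uniq s -> size s = 4 -> ~ (forall y, y \in s -> R x y).
Proof.
move=> tL GL Gm mR us ss H.
case: s us ss H => [//|y0 [//|y1 [//|y2 [//|y3 [|//]]]]].
set s := [:: y0; y1; y2; y3] => us _ H.
have [s0 [s1 [s2 s3]]] : [/\ y0 \in s, y1 \in s, y2 \in s & y3 \in s].
  by rewrite !inE !eqxx !orbT.
have sep y : exists a, forall z, z \in s -> sval z a <-> z <> y.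
  exact: canon_definable.
have [[a0 A0] [a1 A1] [a2 A2] [a3 A3]] := And4 (sep y0) (sep y1) (sep y2) (sep y3).
have := canon_sound (nth Bot [:: a0; a1; a2; a3]) x tL (GL _ Gm).
have /uniq4P[[n01 n02 n03] [n12 n13 n23]] := us.
set V := (V in sat V).
have V0 y : y \in s -> V 0 y <-> y <> y0 by exact: A0.
have V1 y : y \in s -> V 1 y <-> y <> y1 by exact: A1.
have V2 y : y \in s -> V 2 y <-> y <> y2 by exact: A2.
have V3 y : y \in s -> V 3 y <-> y <> y3 by exact: A3.
move=> X; suff : @sat (canon_frame i) V x (m (Imp (Var 0) (Imp (Var 1) (Imp (Var 2) (Var 3))))).
  move=> /mR/(_ _ (H _ s3)) /= h.
  have : V 3 y3 by apply: h; [apply/(V0 _ s3)|apply/(V1 _ s3)|apply/(V2 _ s3)] => /esym.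
  by move/(V3 _ s3).
apply: X.
- by move=> /mR/(_ _ (H _ s0)) /= /(V0 _ s0).
- move=> /mR/(_ _ (H _ s1)) /= h.
  have : V 1 y1 by apply: h; apply/(V0 _ s1) => /esym.
  by move/(V1 _ s1).
- move=> /mR/(_ _ (H _ s2)) /= h.
  have : V 2 y2 by apply: h; [apply/(V0 _ s2)|apply/(V1 _ s2)] => /esym.
  by move/(V2 _ s2).
Qed.

(** By [canon_depth] no point has both a proper successor and a proper predecessor. All its
    neighbours thus lie on one side, and [alt3] for that direction counts them, the point itself
    included. *)
Lemma canon_degree L (i : inhabited (canon_world L)) (x : canon_frame i)
    (s : seq (canon_world L)) :
  tense_logic L -> Ga `<=` L -> uniq s -> size s = 4 ->
  ~ (forall y, y \in s -> adj x y).
Proof.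
move=> tL GL us ss H.
have [[y xy yx]|nxy] := pselect (exists2 y : canon_frame i, acc x y & y <> x).
- apply: (canon_alt3 tL GL (Ga_alt3 (@box_for_Box GZ) Rz_near) (@box_for_Box _) us ss).
  move=> z /H[xz|zx]; first exact: xz.
  have [->|/esym//] := canon_depth tL GL zx xy; exact: canon_refl.
- have near u v : Rz v u -> v = u \/ v = (u - 1)%R \/ v = (u + 1)%R.
    by move/Rz_near; lia.
  apply: (canon_alt3 tL GL (Ga_alt3 (@box_for_HBox GZ) near) (@box_for_HBox _) us ss).
  move=> z /H[xz|zx]; last exact: zx.
  have -> : z = x by apply: contrapT => zx; apply: nxy; exists z.
  exact: canon_refl.
Qed.

(** Two consecutive path edges in the same direction would contradict [canon_depth], so directions
    alternate: odd points are sources and even points sinks, as in [GZ]. *)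
Lemma canon_oriented_path L (i : inhabited (canon_world L)) (p : nat -> canon_frame i) m :
  tense_logic L -> Ga `<=` L ->
  (forall k, k < m -> adj (p k) (p k.+1)) ->
  (forall k l, k <= m -> l <= m -> p k = p l -> k = l) ->
  acc (p 1) (p 0) ->
  forall q, (q.*2.+1 <= m -> acc (p q.*2.+1) (p q.*2)) /\
            (q.*2.+2 <= m -> acc (p q.*2.+1) (p q.*2.+2)).
Proof.
move=> tL GL pE pinj p10.
have down q : (q.*2.+1 <= m -> acc (p q.*2.+1) (p q.*2)) ->
    q.*2.+2 <= m -> acc (p q.*2.+1) (p q.*2.+2).
  move=> IH qm; have [//|h] := pE q.*2.+1 qm.
  by case: (canon_depth tL GL h (IH (ltnW qm))) => /pinj; lia.
elim=> [|q [_ IH]]; first by split=> //; exact: down.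
suff h : q.+1.*2.+1 <= m -> acc (p q.+1.*2.+1) (p q.+1.*2) by split=> //; exact: down.
rewrite doubleS => qm; have [h|//] := pE q.*2.+2 qm.
by case: (canon_depth tL GL (IH (ltnW qm)) h) => /pinj; lia.
Qed.

(* The accessibility relation of [GZ] on natural numbers. *)
Definition Rn (i j : nat) : Prop :=
  i = j \/ exists q, i = q.*2.+1 /\ (j = q.*2 \/ j = q.*2.+2).

(** The shift is even because parity decides whether an integer is a source or a sink. *)
Lemma Rn_Rz (e : int) i j :
  Rn i j <-> Rz (2 * e + Posz i)%R (2 * e + Posz j)%R.
Proof.
split=> [[->|[q [-> h]]]|[h|[q [hi hj]]]]; first by left.
- by right; exists (e + Posz q)%R; lia.
- by left; lia.
- by right; exists `|q - e|%N; lia.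
Qed.

(** An interior point and its two path neighbours already exhaust the bound of [canon_degree], so no
    edge leaves the path there, and the alternating directions give exactly the pattern [Rn]. *)
Lemma canon_path_acc L (i : inhabited (canon_world L)) (p : nat -> canon_frame i) m :
  tense_logic L -> Ga `<=` L ->
  (forall k, k < m -> adj (p k) (p k.+1)) ->
  (forall k l, k <= m -> l <= m -> p k = p l -> k = l) ->
  acc (p 1) (p 0) ->
  [/\ forall k l, k <= m -> l <= m -> Rn k l -> acc (p k) (p l),
      forall k y, 0 < k < m -> acc (p k) y -> exists2 l, y = p l & Rn k l &
      forall k y, 0 < k < m -> acc y (p k) -> exists2 l, y = p l & Rn l k].
Proof.
move=> tL GL pE pinj p10.
have ori := canon_oriented_path tL GL pE pinj p10.
have RnR k l : k <= m -> l <= m -> Rn k l -> acc (p k) (p l).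
  move=> km lm [->|[q [kq lq]]]; first exact: canon_refl.
  by have [h1 h2] := ori q; case: lq km lm => -> ; rewrite kq => ? ?; auto.
have near k y : 0 < k < m -> adj (p k) y ->
    [\/ y = p k.-1, y = p k | y = p k.+1].
  case: k => // k km ky; apply: contrapT => H.
  have [n0 n1 n2] :
      [/\ y <> p k, y <> p k.+1 & y <> p k.+2 :> canon_world L].
    by split=> E; apply: H; rewrite E; [exact: Or31|exact: Or32|exact: Or33].
  apply: (@canon_degree L i (p k.+1) [:: y; p k; p k.+1; p k.+2] tL GL).
  - by apply/uniq4P; split; split=> // /pinj; lia.
  - by [].
  - move=> z; rewrite !inE => /or4P[] /eqP-> //.
    + by have [h|h] := pE k (ltnW km); [right|left].
    + by left; exact: canon_refl.
    + exact: pE.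
have anti k l : k <= m -> l <= m -> Rn k l -> acc (p l) (p k) -> k = l.
  move=> km lm kl lk; have h := RnR _ _ km lm kl.
  by case: (canon_depth tL GL h lk) => /pinj ->.
have RnE k l : k <= m -> l <= m -> l = k \/ l = k.+1 \/ k = l.+1 ->
    acc (p k) (p l) -> Rn k l.
  move=> km lm kl h.
  suff : Rn k l \/ Rn l k.
    by case=> // lk; have := anti _ _ lm km lk h; left.
  have := odd_double_half k; set q := k./2; case: (odd k) => kq.
  - by left; case: kl => [->|[->|kl]]; [left|right; exists q; lia..].
  - case: kl => [->|[->|kl]]; first by left; left.
      by right; right; exists q; lia.
    by right; right; exists q.-1; lia.
split=> // k y km ky.
- have /near : adj (p k) y by left.
  move=> /(_ km) H; have [l E kl] : exists2 l, y = p l & l = k \/ l = k.+1 \/ k = l.+1.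
    by case: H => ->; [exists k.-1|exists k|exists k.+1] => //; lia.
  by exists l => //; apply: RnE => //; [lia|lia|rewrite -E].
- have /near : adj (p k) y by right.
  move=> /(_ km) H; have [l E kl] : exists2 l, y = p l & l = k \/ l = k.+1 \/ k = l.+1.
    by case: H => ->; [exists k.-1|exists k|exists k.+1] => //; lia.
  by exists l => //; apply: RnE => //; [lia|lia|lia|rewrite -E].
Qed.

(* A long path in the canonical frame looks around its middle like a piece of
   [GZ], so it refutes everything that a point of [GZ] refutes. *)
Lemma canon_no_oriented_path L (i : inhabited (canon_world L)) (p : nat -> canon_frame i)
    phi V w :
  let m := (mdepth phi).*2 + 3 in
  tense_logic L -> Ga `<=` L -> L phi -> ~ sat (F := GZ) V w phi ->
  (forall k, k < m -> adj (p k) (p k.+1)) ->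
  (forall k l, k <= m -> l <= m -> p k = p l -> k = l) ->
  ~ acc (p 1) (p 0).
Proof.
move=> m tL GL Lphi nphi pE pinj p10.
have [pR pfw pbw] := canon_path_acc tL GL pE pinj p10.
set d := mdepth phi in m pE pinj pR pfw pbw *.
(* The centre [c] is [d + 1] or [d + 2], whichever has the parity of [w]; the [+ 3] in [m] leaves
   room for both. *)
have [e [c [cd cm wE]]] : exists (e : int) (c : nat), [/\ d < c, c + d < m & w = (2 * e + Posz c)%R].
  have [b [f wf]] : exists (b : bool) (f : int), w = (2 * f + Posz (b + d.+1))%R.
    exists (modz (w - Posz d.+1) 2 == 1%R), (divz (w - Posz d.+1) 2).
    have := divz_eq (w - Posz d.+1) 2; have := modz_ge0 (w - Posz d.+1) (d := 2) isT.
    have := ltz_mod (w - Posz d.+1) (d := 2) isT.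
    by case: eqP; lia.
  by exists f, (b + d.+1); split=> //; rewrite /m; case: b {wf}; lia.
(* On the points of the path, [s n] defines the valuation of variable [n] transported from [GZ]. *)
have /choice[s Hs] : forall n, exists a, forall x, x \in [seq p k | k <- iota 0 m.+1] ->
    sval x a <-> exists2 k, k <= m & x = p k /\ V n (2 * e + Posz k)%R.
  by move=> n; exact: canon_definable.
(* [Z j] pairs positions from which [j] further steps stay strictly inside the path. *)
pose Z (j : nat) (z : GZ) (y : canon_frame i) :=
  exists k, [/\ j < k, k + j < m, z = (2 * e + Posz k)%R & y = p k].
apply/nphi/(sat_bounded_bisim (Z := Z) _ _ _ _ _ (leqnn _)); last first.
- by apply: (canon_sound s); [exact: tL|exact: Lphi].
- by exists c; split; [exact: cd|exact: cm|exact: wE|].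
- move=> j x y y' [k [jk km -> ->]] /(pbw _ _) [|l -> lk]; first by lia.
  exists (2 * e + Posz l)%R; first exact/Rn_Rz.
  by exists l; split=> //; case: lk => [|[q]]; lia.
- move=> j x y z' [k [jk km -> ->]].
  move=> kz'; have [l E] : exists l : nat, z' = (2 * e + Posz l)%R.
    by exists `|((z' : int) - 2 * e)%R|%N; have := Rz_near kz'; lia.
  move: kz'; rewrite E => /Rn_Rz lk.
  exists (p l); first by apply: pR => //; case: lk => [|[q]]; lia.
  by exists l; split=> //; case: lk => [|[q]]; lia.
- move=> j x y y' [k [jk km -> ->]] /(pfw _ _) [|l -> lk]; first by lia.
  exists (2 * e + Posz l)%R; first exact/Rn_Rz.
  by exists l; split=> //; case: lk => [|[q]]; lia.
- move=> j x y z' [k [jk km -> ->]] kz'.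
  have [l E] : exists l : nat, z' = (2 * e + Posz l)%R.
    by exists `|((z' : int) - 2 * e)%R|%N; have := Rz_near kz'; lia.
  move: kz'; rewrite E => /Rn_Rz lk.
  exists (p l); first by apply: pR => //; case: lk => [|[q]]; lia.
  by exists l; split=> //; case: lk => [|[q]]; lia.
- move=> j x y n [k [jk km -> ->]]; split.
  + move=> Vk; apply/Hs; last by exists k => //; lia.
    by apply/mapP; exists k => //; rewrite mem_iota; lia.
  + move=> /Hs[|l lm [/pinj]]; last by move=> <- //; lia.
    by apply/mapP; exists k => //; rewrite mem_iota; lia.
Qed.

Lemma canon_finite_components L (i : inhabited (canon_world L)) phi :
  tense_logic L -> Ga `<=` L -> L phi -> ~ Ga phi ->
  exists K, forall x : canon_world L, exists s : seq (canon_world L),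
    [/\ uniq s, size s <= K, x \in s &
      forall y z, y \in s -> @adj (canon_frame i) y z -> z \in s].
Proof.
move=> tL GL Lphi /existsNP[V /existsNP[w nphi]].
(* Paths of length [m] are excluded by [canon_no_oriented_path] when their first edge points
   backward; a ball of radius [m] has at most [3 ^ m] points, as each point has at most three
   neighbours including itself. *)
set m := (mdepth phi).*2 + 3; exists (3 ^ m) => x.
have adj_refl (z : canon_frame i) : adj z z by left; exact: canon_refl.
have [z||//] := @long_path_or_small_component _ (@adj (canon_frame i)) x 3 m adj_refl.
  by apply: bounded_enum => s us ss; exact: canon_degree.
move=> [p [pE pinj]]; exfalso.
have no (q : nat -> canon_frame i) := canon_no_oriented_path (p := q) tL GL Lphi nphi.
(* The path has one edge to spare: if its first edge points forward, dropping [p 0] leaves a path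
   whose first edge points backward. *)
have [p01|p10] := pE 0 (leq0n m); last first.
  apply: (no p) p10 => [k /ltnW|k l km lm]; first exact: pE.
  by apply: pinj; exact: leqW.
apply: (no (fun k => p k.+1)) => [k|k l km lm /pinj/succn_inj|]; first exact: pE.
  exact.
have m1 : 0 < m by rewrite /m addnS.
have [p12|//] := pE 1 m1.
by case: (canon_depth tL GL p01 p12) => /pinj; lia.
Qed.

Lemma subst_Var a : subst Var a = a.
Proof. by elim: a => //= [b -> c ->|b ->|b ->]. Qed.

(** * A finite frame from finite components *)

(* [t] encodes a frame on [{0, ..., t.1 - 1}]. *)
Definition frame_code (K : nat) : finType :=
  ('I_K.+1 * {ffun 'I_K * 'I_K -> bool})%type.

(** The list [s] is a union of components of the canonical frame and [t.2] its adjacency table;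
    positions past the end of [s] read the default point [x0]. *)
Definition codes (L : set tform) (i : inhabited (canon_world L))
    (x0 : canon_frame i) (K : nat) (t : frame_code K)
    (s : seq (canon_world L)) : Prop :=
  [/\ uniq s, size s = t.1,
      forall y z, y \in s -> @adj (canon_frame i) y z -> z \in s &
      forall k l : 'I_K, t.2 (k, l) <-> @acc (canon_frame i) (nth x0 s k) (nth x0 s l)].

(** A disjoint union with one copy for each realised code, hence finite however many components
    share a code. *)
Definition coded_world (L : set tform) (i : inhabited (canon_world L))
    (x0 : canon_frame i) (K : nat) : Type :=
  {u : frame_code K * 'I_K |
    (u.2 < u.1.1) && `[< exists s, codes x0 u.1 s >]}.

Definition coded_acc (L : set tform) (i : inhabited (canon_world L))
    (x0 : canon_frame i) (K : nat) (u v : coded_world x0 K) : Prop :=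
  (sval u).1 = (sval v).1 /\ (sval u).1.2 ((sval u).2, (sval v).2).

Definition coded_frame (L : set tform) (i : inhabited (canon_world L))
    (x0 : canon_frame i) (K : nat) (h : inhabited (coded_world x0 K)) : frame :=
  Frame (@coded_acc L i x0 K) h.

Lemma coded_world_exists (L : set tform) (i : inhabited (canon_world L))
    (x0 : canon_frame i) (K : nat) (t : frame_code K) s y :
  codes x0 t s -> y \in s ->
  exists2 u : coded_world x0 K, (sval u).1 = t & y = nth x0 s (sval u).2.
Proof.
move=> ts ys; have [_ st _ _] := ts.
have yt : index y s < t.1 by rewrite -st index_mem.
have yK : index y s < K by rewrite (leq_trans yt) // -ltnS.
have h : ((t, Ordinal yK).2 < (t, Ordinal yK).1.1) &&
    `[< exists s, codes x0 (t, Ordinal yK).1 s >].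
  by apply/andP; split=> //; apply/asboolP; exists s.
by exists (exist _ (t, Ordinal yK) h) => //=; rewrite nth_index.
Qed.

(** Reading positions in [s] maps the copy with code [t] onto a part of the canonical frame closed
    in both directions, and this map is a bisimulation; [f] gives formulas defining the valuation
    there. *)
Lemma coded_truth (L : set tform) (i : inhabited (canon_world L))
    (x0 : canon_frame i) (K : nat) (h : inhabited (coded_world x0 K))
    (t : frame_code K) s (V : nat -> set (coded_frame h)) f a
    (u : coded_frame h) :
  tense_logic L -> codes x0 t s ->
  (forall n (v : coded_frame h), (sval v).1 = t -> V n v <-> sval (nth x0 s (sval v).2) (f n)) ->
  (sval u).1 = t ->
  sat V u a <-> sval (nth x0 s (sval u).2) (subst f a).
Proof.
move=> tL ts Vf ut; rewrite -(propext (canon_truth (i := i) f a _ tL)).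
have [_ st cls accE] := ts.
have us (v : coded_frame h) : (sval v).1 = t -> nth x0 s (sval v).2 \in s.
  by move=> vt; rewrite mem_nth // st -vt; case/andP: (svalP v).
pose Z (_ : nat) (v : coded_frame h) (y : canon_frame i) :=
  (sval v).1 = t /\ y = nth x0 s (sval v).2.
apply: (sat_bounded_bisim (Z := Z) _ _ _ _ _ (leqnn _)); last by [].
- by move=> k v y n [vt ->]; exact: Vf.
- move=> k v y v' [vt ->] [vv' h']; exists (nth x0 s (sval v').2).
    by apply/accE; rewrite -vt.
  by split=> //; rewrite -vv'.
- move=> k v y y' [vt ->] yy'.
  have /(coded_world_exists ts)[v' v't y'E] : y' \in s.
    by apply: cls (us v vt) _; left.
  exists v' => //; split; first by rewrite vt.
  by rewrite vt; apply/accE; rewrite -y'E.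
- move=> k v y v' [vt ->] [vv' h']; exists (nth x0 s (sval v').2).
    by apply/accE; rewrite -vt -vv'.
  by split=> //; rewrite vv'.
- move=> k v y y' [vt ->] yy'.
  have /(coded_world_exists ts)[v' v't y'E] : y' \in s.
    by apply: cls (us v vt) _; right.
  exists v' => //; split; first by rewrite vt.
  by rewrite v't; apply/accE; rewrite -y'E.
Qed.

Lemma finite_components_tabular (L : set tform) (i : inhabited (canon_world L)) K :
  tense_logic L ->
  (forall x : canon_world L, exists s : seq (canon_world L),
    [/\ uniq s, size s <= K, x \in s &
      forall y z, y \in s -> @adj (canon_frame i) y z -> z \in s]) ->
  tabular L.
Proof.
move=> tL comp; have [x0] := i.
have code x : exists t s, codes (x0 : canon_frame i) (t : frame_code K) s /\ x \in s.
  have [s [us sK xs cls]] := comp x.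
  have sK' : size s < K.+1 by [].
  exists (Ordinal sK', [ffun kl : 'I_K * 'I_K =>
    `[< @acc (canon_frame i) (nth x0 s kl.1) (nth x0 s kl.2) >]]), s.
  split=> //; split=> // k l; rewrite ffunE /=.
  by split=> [/asboolP|H]; [|apply/asboolP].
have h : inhabited (coded_world (x0 : canon_frame i) K).
  have [t [s [ts xs]]] := code x0.
  by have [u _ _] := coded_world_exists ts xs; exists.
exists (coded_frame h); split.
  exact: (@finite_finset (coded_world (x0 : canon_frame i) K : finType)).
apply/seteqP; split=> a.
- move=> La V u.
  have /andP[ut /asboolP[s ts]] := svalP u.
  (* On the finite list [s] an arbitrary valuation is given by formulas, so a substitution instance
     of [a], again a theorem of [L], settles the truth of [a] at [u]. *)
  have /choice[f Hf] : forall n, exists b, forall y, y \in s ->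
      sval y b <-> exists2 v : coded_frame h, (sval v).1 = (sval u).1 & y = nth x0 s (sval v).2 /\ V n v.
    by move=> n; exact: canon_definable.
  have [us st _ _] := ts.
  apply: (iffRL (coded_truth (f := f) a tL ts _ _)) => // [n v vu|]; last exact/canon_thm/(tl_subst tL).
  rewrite (propext (Hf n _ _)); last by rewrite mem_nth // st -vu; case/andP: (svalP v).
  split=> [Vv|[v' v'u [/eqP]]]; first by exists v.
  (* As [s] has no repetitions, equal canonical points come from equal positions. *)
  rewrite nth_uniq // ?st -?vu //; last first.
  - by rewrite vu -v'u; case/andP: (svalP v').
  - by case/andP: (svalP v).
  move=> /eqP/val_inj vv' Vv'; suff -> : v = v' by [].
  by apply: val_inj; apply: injective_projections => //=; rewrite vu.
- move=> Fa; apply/(canon_complete _ tL) => x.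
  have [t [s [ts xs]]] := code x.
  have [u ut xE] := coded_world_exists ts xs.
  rewrite xE -(subst_Var a).
  (* The standard canonical valuation, pulled back to the copy, carries validity of [a] in the
     finite frame over to membership of [a] in [x]. *)
  pose V n := [set v : coded_frame h | sval (nth x0 s (sval v).2) (Var n)].
  exact: (iffLR (coded_truth (V := V) (u := u) a tL ts _ ut) (Fa V u)).
Qed.

Theorem theorem7p7 : PTAB S4BP_2omega_22 Ga.
Proof.
split; last exact: S4BP_sub_Ga.
split; [exact: Log_tense_logic|exact: Ga_not_tabular|].
move=> M tM cM [GM /existsNP[phi /not_implyP[Mphi Gphi]]].
(* Without maximal consistent sets, completeness would make [Bot] a theorem of [M]. *)
have i : inhabited (canon_world M).
  apply: contrapT => ni; apply/cM/(canon_complete _ tM) => x.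
  by case: ni; exists.
have [K comp] := canon_finite_components i tM GM Mphi Gphi.
exact: finite_components_tabular comp.
Qed.
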